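(* For all integers $m \ge 2$ and $n \ge 3$, $\chi_{la}(K_n \circ \overline{K_m}) = mn+n$, where $K_n$ is the complete graph on $n$ vertices.
   Context: Let $G=(V,E)$ be a finite simple undirected graph with no component isomorphic to $K_2$. A bijection $f : E \to \{1,2,\dots,|E|\}$ is a local antimagic labeling of $G$ if $w(u)\ne w(v)$ for every pair of adjacent vertices $u,v$, where $w(u)=\sum_{e\in E(u)} f(e)$ and $E(u)$ is the set of edges incident to $u$. Such an $f$ induces the proper vertex coloring $v\mapsto w(v)$, which uses $|\{w(v): v\in V\}|$ colors. The local antimagic chromatic number $\chi_{la}(G)$ is the minimum number of colors used over all colorings induced by local antimagic labelings of $G$ (so $\chi_{la}(G)\le k$ means that there is a local antimagic labeling inducing at most $k$ colors). The corona product $G\circ H$ is obtained from one copy of $G$ and $|V(G)|$ copies of $H$ by joining the $i$-th vertex of $G$ to every vertex of the $i$-th copy of $H$, for $1\le i\le |V(G)|$. $\overline{K_m}$ is the null (edgeless) graph on $m$ vertices. *)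

(* Defs.v *)
From mathcomp Require Import all_boot.

Set Implicit Arguments.
Unset Strict Implicit.
Unset Printing Implicit Defensive.

Record sgraph := SGraph {
  vertex :> finType;
  adj : rel vertex;
  adj_sym : symmetric adj;
  adj_irrefl : irreflexive adj
}.

Definition edges (G : sgraph) : {set {set G}} :=
  [set [set p.1; p.2] | p : G * G & adj p.1 p.2].

Notation edge G := {e : {set vertex G} | e \in edges G}.

(* The label set {1, ..., |E|} is encoded by 'I_#|E|: the ordinal i stands for
   the label i.+1. *)
Definition labeling (G : sgraph) : Type := edge G -> 'I_#|edges G|.

Definition label (G : sgraph) (f : labeling G) (e : edge G) : nat := (f e).+1.

Definition weight (G : sgraph) (f : labeling G) (v : G) : nat :=
  \sum_(e : edge G | v \in val e) label f e.

Definition local_antimagic (G : sgraph) (f : labeling G) : Prop :=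
  bijective f /\ forall u v : G, adj u v -> weight f u <> weight f v.

Definition num_colors (G : sgraph) (f : labeling G) : nat :=
  size (undup [seq weight f v | v : G]).

(* chi_la(G) = k. The minimum is expressed as a relation because a graph with a
   K_2 component has no local antimagic labeling, hence no such k. *)
Definition is_chi_la (G : sgraph) (k : nat) : Prop :=
  (exists f : labeling G, local_antimagic f /\ num_colors f = k) /\
  (forall f : labeling G, local_antimagic f -> k <= num_colors f).

Section CompleteAndNull.
Variable n : nat.

Definition complete_adj : rel 'I_n := fun x y => x != y.

Fact complete_adj_sym : symmetric complete_adj.
Proof. by move=> x y; rewrite /complete_adj eq_sym. Qed.

Fact complete_adj_irrefl : irreflexive complete_adj.
Proof. by move=> x; rewrite /complete_adj eqxx. Qed.

Definition complete_graph : sgraph :=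
  SGraph complete_adj_sym complete_adj_irrefl.

Definition null_adj : rel 'I_n := fun _ _ => false.

Fact null_adj_sym : symmetric null_adj.
Proof. by []. Qed.

Fact null_adj_irrefl : irreflexive null_adj.
Proof. by []. Qed.

Definition null_graph : sgraph := SGraph null_adj_sym null_adj_irrefl.

End CompleteAndNull.

Section Corona.
Variables G H : sgraph.

(* inr (x, a) is the vertex a of the copy of H attached to the vertex x of G. *)
Definition corona_adj : rel (G + G * H)%type := fun p q =>
  match p, q with
  | inl x, inl y => adj x y
  | inl x, inr (y, _) => x == y
  | inr (x, _), inl y => x == y
  | inr (x, a), inr (y, b) => (x == y) && adj a b
  end.

Fact corona_adj_sym : symmetric corona_adj.
Proof.
case=> [x|[x a]] [y|[y b]] /=; [exact: adj_sym | exact: eq_sym..|].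
by rewrite eq_sym adj_sym.
Qed.

Fact corona_adj_irrefl : irreflexive corona_adj.
Proof. by case=> [x|[x a]] /=; rewrite adj_irrefl ?andbF. Qed.

Definition corona : sgraph := SGraph corona_adj_sym corona_adj_irrefl.

End Corona.

(* Main.v *)
(** A pendant vertex carries the label of its only edge, so pendant weights are
    distinct and at most the number |E| of edges. A clique vertex has degree
    n + m - 1, so its weight is at least 'C(n + m, 2), which exceeds
    |E| = 'C(n, 2) + n * m because m >= 2. Hence every local antimagic labeling
    is injective on weights, and it only remains to find one labeling with
    distinct weights on the clique. Number the clique vertices by 'I_n, give each
    pendant vertex the number of its neighbor, and label the edges in increasing
    order of the sum of the numbers of their ends: replacing x by a larger x' then
    increases every term of the weight of x except the label of the edge xx'. *)

Require Import Defs.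
From mathcomp Require Import all_boot.

Set Implicit Arguments.
Unset Strict Implicit.
Unset Printing Implicit Defensive.

(** Among k + 1 distinct naturals some b is at least k, since otherwise all of them would lie in {0,
    ..., k - 1}. Removing b leaves k distinct naturals, and 'C(k + 1, 2) = 'C(k, 2) + k. *)
Lemma leq_bin2_sum_uniq (s : seq nat) :
  uniq s -> 'C(size s, 2) <= \sum_(i <- s) i.
Proof.
have [k] := ubnP (size s); elim: k s => // k IHk [|a s] // ltk uniq_s.
have /hasP[b sb le_sb]: has (leq (size s)) (a :: s).
  apply/hasPn=> small; have /uniq_leq_size := uniq_s.
  move/(_ (iota 0 (size s))); rewrite size_iota ltnn => sub.
  suff /sub : {subset a :: s <= iota 0 (size s)} by [].
  by move=> i /small; rewrite mem_iota -ltnNge.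
rewrite (perm_big _ (perm_to_rem sb)) big_cons /= binS bin1 addnC leq_add //.
have szr : size (rem b (a :: s)) = size s by rewrite size_rem.
rewrite -szr; apply: IHk; last exact: rem_uniq.
by rewrite szr.
Qed.

Lemma leq_bin2_sum_inj (T : finType) (A : {pred T}) (g : T -> nat) :
  {in A &, injective g} -> 'C(#|A|.+1, 2) <= \sum_(x in A) (g x).+1.
Proof.
move=> g_inj; have: 'C(#|A|, 2) <= \sum_(x in A) g x.
  rewrite -big_enum -(big_map g predT id) cardE -(size_map g).
  apply: leq_bin2_sum_uniq; rewrite map_inj_in_uniq ?enum_uniq // => x y.
  by rewrite !mem_enum; apply: g_inj.
under [X in _ -> _ <= X]eq_bigr do rewrite -addn1.
by rewrite binS bin1 big_split /= sum1_card leq_add2r.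
Qed.

Lemma bin2D n m : 'C(n + m, 2) = 'C(n, 2) + n * m + 'C(m, 2).
Proof.
elim: m => [|m IHm]; first by rewrite muln0 !addn0.
by rewrite addnS !binS !bin1 IHm mulnS -!addnA; congr (_ + _); rewrite (addnCA 'C(m, 2)) addnCA.
Qed.

(** Sort [T] by [key] and send each element to its position. Elements with equal keys are ordered
    arbitrarily, so only strict inequalities of keys carry over. *)
Lemma ranking_exists (T : finType) (key : T -> nat) k :
  #|T| = k ->
  exists2 f : T -> 'I_k, bijective f & forall x y, key x < key y -> f x < f y.
Proof.
move=> <-; pose leT := relpre key leq; pose s := sort leT (enum T).
have mem_s x : x \in s by rewrite mem_sort mem_enum.
have lt_s x : index x s < #|T| by rewrite cardE -(size_sort leT) index_mem.
exists (fun x => Ordinal (lt_s x)) => [|x y /=].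
  apply: inj_card_bij; last by rewrite card_ord.
  by move=> x y [] /index_inj; apply.
rewrite !ltnNge; apply: contra => le_yx.
have leT_tr : transitive leT by move=> ? ? ?; apply: leq_trans.
have leT_refl : reflexive leT by move=> ?; apply: leqnn.
have s_sorted : sorted leT s by apply: sort_sorted => ? ?; apply: leq_total.
exact: (sorted_leq_index leT_tr leT_refl s_sorted) (mem_s y) (mem_s x) le_yx.
Qed.

Section Labelings.
Variables (G : sgraph) (f : labeling G).

(** Extending labels by 0 to all vertex sets lets sums over neighbors avoid membership proofs; true
    labels are positive. *)
Definition set_label (e : {set G}) : nat := oapp (label f) 0 (insub e).

Lemma set_label_val (e : edge G) : set_label (val e) = label f e.
Proof. by rewrite /set_label valK. Qed.

Lemma set_label_leq e : set_label e <= #|edges G|.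
Proof. by rewrite /set_label; case: insub => //= e'; apply: ltn_ord. Qed.

Lemma set_label_gt0 e : e \in edges G -> 0 < set_label e.
Proof. by move=> Ge; rewrite -[e]/(val (Sub e Ge : edge G)) set_label_val. Qed.

Lemma set_label_inj : injective f -> {in edges G &, injective set_label}.
Proof.
move=> f_inj e e' Ge Ge'.
rewrite -[e]/(val (Sub e Ge : edge G)) -[e']/(val (Sub e' Ge' : edge G)).
by rewrite !set_label_val => -[] /val_inj /f_inj ->.
Qed.

Lemma mem_edges (u v : G) : adj u v -> [set u; v] \in edges G.
Proof. by move=> uv; apply/imsetP; exists (u, v); rewrite ?inE. Qed.

Lemma set2_injr (T : finType) (v : T) : injective (fun u => [set v; u]).
Proof.
move=> a b /setP eq_ab; have := eq_ab a; have := eq_ab b.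
rewrite !inE !eqxx !orbT; case/orP=> /eqP-> //.
by rewrite orbb => /esym/eqP.
Qed.

(** The map sending u to {v, u} is a bijection from the neighbors of v to the edges at v. *)
Lemma weightE (v : G) : weight f v = \sum_(u | adj v u) set_label [set v; u].
Proof.
transitivity (\sum_(e in [set [set v; u] | u in adj v]) set_label e); last first.
  by rewrite big_imset //= => a b _ _; apply: set2_injr.
rewrite /weight (eq_bigr (fun e => set_label (val e))) => [|e _]; last first.
  by rewrite set_label_val.
rewrite -(big_sub_cond (fun e => e \in edges G) (fun e => v \in e) set_label).
apply: eq_bigl => e; apply/andP/imsetP => [[]|[u vu ->]]; last first.
  by rewrite mem_edges ?set21.
case/imsetP=> -[a b] ab ->; rewrite inE in ab *.
case/set2P=> ->; first by exists b.
by exists a; [have : adj b a by rewrite adj_sym | rewrite setUC].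
Qed.

(** The labels at v are distinct positive integers, so their sum is at least 1 + ... + deg v. *)
Lemma leq_bin2_weight (v : G) :
  injective f -> 'C(#|[pred u | adj v u]|.+1, 2) <= weight f v.
Proof.
move=> f_inj; pose g u := (set_label [set v; u]).-1.
have gE u : adj v u -> (g u).+1 = set_label [set v; u].
  by move=> vu; rewrite prednK ?set_label_gt0 ?mem_edges.
have g_inj : {in [pred u | adj v u] &, injective g}.
  move=> u u' vu vu' /(congr1 S); rewrite !gE // => eq_l.
  by apply: (@set2_injr _ v); apply: set_label_inj => //; apply: mem_edges.
apply: leq_trans (leq_bin2_sum_inj g_inj) _.
by rewrite weightE (eq_bigr _ gE).
Qed.

End Labelings.

Lemma num_colors_inj (G : sgraph) (f : labeling G) :
  injective (weight f) -> num_colors f = #|G|.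
Proof.
move=> w_inj; rewrite /num_colors undup_id; first by rewrite size_map -cardE.
by rewrite map_inj_uniq ?enum_uniq.
Qed.

Lemma labeling_exists (G : sgraph) (key : {set G} -> nat) :
  exists2 f : labeling G, bijective f &
    {in edges G &, forall e e', key e < key e' -> set_label f e < set_label f e'}.
Proof.
have cardG : #|{: edge G}| = #|edges G| by rewrite card_sig; apply: eq_card.
have [f f_bij f_mono] := ranking_exists (fun e : edge G => key (val e)) cardG.
exists f => // e e' Ge Ge'.
rewrite -[e]/(val (Sub e Ge : edge G)) -[e']/(val (Sub e' Ge' : edge G)).
by rewrite !set_label_val; apply: f_mono.
Qed.

Section CompleteCorona.
Variables m n : nat.
Hypothesis m_gt1 : 1 < m.

Local Notation G := (corona (complete_graph n) (null_graph m)).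
Local Notation core x := (inl x : G).
Local Notation leaf x a := (inr (x, a) : G).

Lemma card_corona : #|G| = m * n + n.
Proof. by rewrite card_sum card_prod !card_ord addnC mulnC. Qed.

Lemma card_edges_corona : #|edges G| <= 'C(n, 2) + n * m.
Proof.
pose core_edges := [set [set core x | x in A] | A : {set 'I_n} & #|A| == 2].
pose leaf_edges := [set [set core p.1; leaf p.1 p.2] | p : 'I_n * 'I_m].
have sub : edges G \subset core_edges :|: leaf_edges.
  apply/subsetP=> e /imsetP[[[x|[x a]] [y|[y b]]]]; rewrite inE //= => xy ->.
  - rewrite inE; apply/orP; left; apply/imsetP; exists [set x; y].
      by rewrite inE cards2 (xy : x != y).
    by rewrite imsetU1 imset_set1.
  - rewrite inE; apply/orP; right; apply/imsetP; exists (x, b) => //=.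
    by rewrite (eqP xy).
  - rewrite inE; apply/orP; right; apply/imsetP; exists (y, a) => //=.
    by rewrite (eqP xy) setUC.
  by rewrite andbF in xy.
apply: leq_trans (subset_leq_card sub) _; apply: leq_trans (leq_card_setU _ _) _.
rewrite leq_add //; apply: leq_trans (leq_imset_card _ _) _.
  by rewrite -[n in 'C(n, 2)]card_ord -card_draws subset_leq_card.
by rewrite card_prod !card_ord.
Qed.

Lemma big_core (x : 'I_n) (F : G -> nat) :
  \sum_(u | adj (core x) u) F u =
    \sum_(y | x != y) F (core y) + \sum_(a < m) F (leaf x a).
Proof.
rewrite big_sumType; congr (_ + _) => /=.
rewrite (eq_bigr (fun p => F (leaf p.1 p.2))) => [|[] //].
(* The conjunct [true] puts the predicate in the product form expected by [pair_big]. *)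
rewrite (eq_bigl (fun p => (x == p.1) && true)) => [|[y a] /=]; last by rewrite andbT.
rewrite -(pair_big (fun y => x == y) xpredT (fun y a => F (leaf y a))) /=.
by rewrite (big_pred1 x) // => y; rewrite eq_sym.
Qed.

Lemma card_adj_core (x : 'I_n) : (#|[pred u | adj (core x) u]|).+1 = n + m.
Proof.
rewrite -sum1_card big_core !sum_nat_const card_ord !muln1 -addSn; congr (_ + _).
rewrite -[RHS]card_ord -(cardC (pred1 x)) card1 add1n; congr _.+1.
by apply: eq_card => y; rewrite !inE unfold_in eq_sym.
Qed.

(** By [bin2D], 'C(n + m, 2) exceeds the bound on the number of edges by 'C(m, 2), which is positive
    because 1 < m. *)
Lemma weight_core_gt (f : labeling G) (x : 'I_n) :
  injective f -> #|edges G| < weight f (core x).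
Proof.
move=> f_inj; apply: leq_trans (leq_bin2_weight (core x) f_inj).
rewrite card_adj_core bin2D -addn1 leq_add ?card_edges_corona //.
by rewrite bin_gt0.
Qed.

Lemma weight_leaf (f : labeling G) x a :
  weight f (leaf x a) = set_label f [set leaf x a; core x].
Proof.
rewrite weightE (big_pred1 (core x)) // => -[y|[y b]] /=; last by rewrite andbF.
by rewrite eq_sym.
Qed.

Lemma weight_core_lt (f : labeling G) (key : G -> nat) (x x' : 'I_n) :
  {in edges G &, forall e e' : {set G}, \sum_(v in e) key v < \sum_(v in e') key v ->
     set_label f e < set_label f e'} ->
  key (core x) < key (core x') ->
  (forall a, key (leaf x a) <= key (leaf x' a)) ->
  weight f (core x) < weight f (core x').
Proof.
move=> f_mono lt_core le_leaf; have neq_xx' : x != x'.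
  by apply: contraTneq lt_core => ->; rewrite ltnn.
have sumU (u v : G) : adj u v -> \sum_(w in [set u; v]) key w = key u + key v.
  move=> uv; rewrite big_setU1 ?big_set1 // inE.
  by apply: contraTneq uv => ->; rewrite adj_irrefl.
have lt_label (u v u' v' : G) : adj u v -> adj u' v' ->
    key u + key v < key u' + key v' ->
    set_label f [set u; v] < set_label f [set u'; v'].
  by move=> uv uv' lt_k; apply: f_mono; rewrite ?mem_edges ?sumU.
(* Strictness is assigned to the sum over leaves: for n = 2 the sums over core neighbors are
   equal. *)
rewrite !weightE !big_core -addnS leq_add //.
  (* The edge xx' contributes the same label to both sums. The remaining core neighbors of x and x'
     coincide and are compared term by term. *)
  rewrite (bigD1 x') //= [leqRHS](bigD1 x) 1?eq_sym //= setUC leq_add2l.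
  rewrite [leqRHS](eq_bigl (fun y => (x != y) && (y != x'))) => [|y]; last first.
    by rewrite andbC ![x' == _]eq_sym [x == _]eq_sym.
  apply: leq_sum => y /andP[xy yx']; apply: ltnW; apply: lt_label => //.
    by rewrite /= /complete_adj eq_sym.
  by rewrite ltn_add2r.
have lt_leaf a : set_label f [set core x; leaf x a]
               < set_label f [set core x'; leaf x' a].
  by apply: lt_label; rewrite /= ?eqxx // -addSn leq_add.
(* A single leaf index suffices for a strict inequality between the leaf sums. *)
have a0 : 'I_m := Ordinal (ltnW m_gt1).
rewrite (bigD1 a0) //= [leqRHS](bigD1 a0) //= -addSn leq_add //.
by apply: leq_sum => a _; apply: ltnW.
Qed.

Lemma weight_inj (f : labeling G) :
  injective f -> injective (fun x => weight f (core x)) ->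
  injective (weight f).
Proof.
move=> f_inj core_inj.
have leaf_lt_core y b x : weight f (leaf y b) < weight f (core x).
  rewrite weight_leaf; apply: leq_ltn_trans (set_label_leq _ _) _.
  exact: weight_core_gt.
case=> [x|[x a]] [y|[y b]] eq_w.
- by congr inl; apply: core_inj.
- by have := leaf_lt_core y b x; rewrite eq_w ltnn.
- by have := leaf_lt_core x a y; rewrite eq_w ltnn.
rewrite !weight_leaf in eq_w.
have Gl z c : [set leaf z c; core z] \in edges G by apply: mem_edges => /=.
(* Equal labels force equal edges, and the only leaf in the second edge is [leaf y b]. *)
have /setP/(_ (leaf x a)) := set_label_inj f_inj (Gl x a) (Gl y b) eq_w.
by rewrite !inE eqxx => /esym/orP[/eqP|/eqP].
Qed.

End CompleteCorona.

Theorem theorem4p2 (m n : nat) (hm : 2 <= m) (hn : 3 <= n) :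
  is_chi_la (corona (complete_graph n) (null_graph m)) (m * n + n).
Proof.
set G := corona _ _; split.
  pose key (v : G) : nat := match v with inl x => x | inr (x, _) => x end.
  have [f f_bij f_mono] := labeling_exists (fun e : {set G} => \sum_(v in e) key v).
  have lt_core (x y : 'I_n) : x < y -> weight f (inl x) < weight f (inl y).
    by move=> xy; apply: (weight_core_lt hm f_mono) => // a; apply: ltnW.
  have w_inj : injective (weight f).
    apply: (weight_inj hm (bij_inj f_bij)) => x y eq_w.
    by apply/val_inj; case: (ltngtP x y) => // /lt_core; rewrite eq_w ltnn.
  exists f; split; last by rewrite num_colors_inj ?card_corona.
  split=> // u v uv /w_inj eq_uv.
  by rewrite eq_uv adj_irrefl in uv.
(* Core vertices are pairwise adjacent, so any local antimagic labeling separates their weights and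
   [weight_inj] applies. *)
move=> f [f_bij f_adj]; rewrite num_colors_inj ?card_corona //.
apply: (weight_inj hm (bij_inj f_bij)) => x y eq_w.
by apply: contraPeq eq_w => xy; apply: f_adj.
Qed.
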